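(* Let $V$ be an admissible $(\mathfrak g,K)$-module. On $K$-highest weight vectors of $V$ the following identity holds: $$(H_\alpha+H_\gamma+2)[Q,R]=(H_\beta-1)[B_{\alpha+\beta+\gamma},A_{\alpha+\beta+\gamma}]+(H_\alpha+H_\beta+H_\gamma+1)[A_\beta,B_\beta].$$
   Context: Let $\mathfrak g=\mathfrak{sl}(4,\mathbb C)$ with matrix units $E_{ij}$, and let $K=S(U(2)\times U(2))$ (block diagonal) be the maximal compact subgroup of $SU(2,2)$. Put $H_\alpha=E_{11}-E_{22}$, $H_\beta=E_{22}-E_{33}$, $H_\gamma=E_{33}-E_{44}$; $X_\alpha=E_{12}$, $X_\beta=E_{23}$, $X_\gamma=E_{34}$, $X_{\alpha+\beta}=E_{13}$, $X_{\beta+\gamma}=E_{24}$, $X_{\alpha+\beta+\gamma}=E_{14}$; and $Y_\delta=X_\delta^{t}$ (transpose) for each positive root $\delta$. Put $H_0=H_\alpha+2H_\beta+H_\gamma$. $V$ is an admissible $(\mathfrak g,K)$-module. A $K$-highest weight vector of weight $(n,k,m)$ ($n,m\in\mathbb Z_{\ge0}$, $k\in\mathbb Z$) is $v\in V$ with $X_\alpha v=X_\gamma v=0$, $H_\alpha v=nv$, $H_\gamma v=mv$, $H_0v=kv$ (so $H_\beta v=\tfrac12(k-n-m)v$). The following operators map the span of $K$-highest weight vectors to itself (products are compositions, the rightmost factor acting first): $A_{\alpha+\beta+\gamma}=X_{\alpha+\beta+\gamma}$; $A_\beta=X_\beta(H_\alpha+1)(H_\gamma+1)-Y_\alpha X_{\alpha+\beta}(H_\gamma+1)+Y_\gamma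 X_{\beta+\gamma}(H_\alpha+1)-Y_\alpha Y_\gamma X_{\alpha+\beta+\gamma}$; $B_{\alpha+\beta+\gamma}=Y_{\alpha+\beta+\gamma}(H_\alpha+1)(H_\gamma+1)+Y_\alpha Y_{\beta+\gamma}(H_\gamma+1)-Y_\gamma Y_{\alpha+\beta}(H_\alpha+1)-Y_\alpha Y_\gamma Y_\beta$; $B_\beta=Y_\beta$; $Q=X_{\alpha+\beta}X_{\beta+\gamma}-X_\beta X_{\alpha+\beta+\gamma}$; $R=Y_{\alpha+\beta}Y_{\beta+\gamma}-Y_\beta Y_{\alpha+\beta+\gamma}$. Commutators are $[S,T]=ST-TS$. *)

(* Defs.v *)
From HB Require Import structures.
From mathcomp Require Import all_boot all_order all_algebra.
From mathcomp Require Import complex.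
From mathcomp Require Import all_classical all_reals all_analysis.

Set Implicit Arguments.
Unset Strict Implicit.
Unset Printing Implicit Defensive.

Import Order.TTheory GRing.Theory Num.Theory numFieldNormedType.Exports.
Local Open Scope classical_set_scope.
Local Open Scope ring_scope.
Local Open Scope complex_scope.

(* The complex numbers as a numClosedFieldType; at this type, unlike at R[i],
   inference finds the norm topology on C and on matrices over C. *)
Definition cplx (R : realType) : numClosedFieldType := R[i].

Section Groups.
Variable R : realType.
Local Notation C := (cplx R).

Definition sl4 : set 'M[C]_4 := [set X | \tr X = 0].

Definition bracket (X Y : 'M[C]_4) : 'M[C]_4 := X *m Y - Y *m X.

(* K = S(U(2) x U(2)) *)
Definition K : set 'M[C]_4 :=
  [set k | exists a d : 'M[C]_2,
     [/\ a \is unitarymx, d \is unitarymx, \det k = 1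
       & k = block_mx a 0 0 d :> 'M[C]_(2 + 2)]].

(* The real Lie algebra s(u(2) + u(2)) of K. *)
Definition LieK : set 'M[C]_4 :=
  [set X | exists a d : 'M[C]_2,
     [/\ map_mx Num.conj a^T = - a, map_mx Num.conj d^T = - d, \tr X = 0
       & X = block_mx a 0 0 d :> 'M[C]_(2 + 2)]].

Definition expm (X : 'M[C]_4) : 'M[C]_4 :=
  limn (fun N : nat => \sum_(j < N) (j`!%:R)^-1 *: X ^+ j).

(* f : R -> C has derivative l at 0. *)
Definition has_deriv0 (f : R -> C) (l : C) : Prop :=
  ((h^-1)%:C : C) * (f h - f 0) @[h --> (0 : R)^'] --> l.

(* Matrices outside K carry no constraint under tau. *)
Record finrep (W : vectType C) (tau : 'M[C]_4 -> 'End(W)) : Prop := FinRep {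
  finrep1 : tau 1%:M = \1%VF;
  finrepM : forall k l, K k -> K l -> tau (k *m l) = (tau k \o tau l)%VF;
  finrep_cont : forall (w : W) (i : 'I_(\dim {:W})),
    {within K, continuous (fun k => coord (vbasis {:W}) i (tau k w))}
}.

Definition irreducible (W : vectType C) (tau : 'M[C]_4 -> 'End(W)) : Prop :=
  {:W}%VS <> 0%VS /\
  forall U : {vspace W},
    (forall k, K k -> (tau k @: U <= U)%VS) -> U = 0%VS \/ U = {:W}%VS.

End Groups.

Section Modules.
Variables (R : realType) (V : lmodType (cplx R)).
Local Notation C := (cplx R).

Definition intertwiner (W : vectType C) (tau : 'M[C]_4 -> 'End(W))
    (kappa : 'M[C]_4 -> {linear V -> V}) (f : {linear W -> V}) : Prop :=
  forall k, K k -> forall w, f (tau k w) = kappa k (f w).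

(* V is a (g, K)-module for the actions rho of g = sl(4, C) and kappa of K;
   rho and kappa are total functions, constrained only on sl4 and K.
   The last field says that every v lies in a finite-dimensional K-stable
   subspace j(W) on which K acts continuously, with differential rho. *)
Record gKmodule (rho kappa : 'M[C]_4 -> {linear V -> V}) : Prop := GKModule {
  gK_lin : forall (a : C) X Y, sl4 X -> sl4 Y ->
    forall v, rho (a *: X + Y) v = a *: rho X v + rho Y v;
  gK_bracket : forall X Y, sl4 X -> sl4 Y ->
    forall v, rho (bracket X Y) v = rho X (rho Y v) - rho Y (rho X v);
  gK_grp1 : forall v, kappa 1%:M v = v;
  gK_grpM : forall k l, K k -> K l ->
    forall v, kappa (k *m l) v = kappa k (kappa l v);
  gK_Ad : forall k X, K k -> sl4 X ->
    forall v, kappa k (rho X v) = rho (k *m X *m invmx k) (kappa k v);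
  gK_finite : forall v : V,
    exists (W : vectType C) (tau : 'M[C]_4 -> 'End(W)) (j : {linear W -> V}),
      [/\ finrep tau, injective j, intertwiner tau kappa j,
          exists w, v = j w
        & forall X, LieK X -> forall w : W, exists w' : W,
            rho X (j w) = j w' /\
            forall i : 'I_(\dim {:W}),
              has_deriv0 (fun t : R =>
                        coord (vbasis {:W}) i (tau (expm (t%:C *: X)) w))
                     (coord (vbasis {:W}) i w')]
}.

(* Every irreducible finite-dimensional continuous representation W of K has
   finite multiplicity in V, i.e. Hom_K(W, V) is finite-dimensional. *)
Definition admissible (kappa : 'M[C]_4 -> {linear V -> V}) : Prop :=
  forall (W : vectType C) (tau : 'M[C]_4 -> 'End(W)),
    finrep tau -> irreducible tau ->
    exists (N : nat) (e : 'I_N -> {linear W -> V}),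
      (forall s, intertwiner tau kappa (e s)) /\
      forall f : {linear W -> V}, intertwiner tau kappa f ->
        exists c : 'I_N -> C, forall w, f w = \sum_(s < N) c s *: e s w.

End Modules.

Section RootVectors.
Variable R : realType.
Local Notation C := (cplx R).

(* Matrix units, with indices 1, 2, 3, 4. *)
Definition E (i j : nat) : 'M[C]_4 := delta_mx (inord i.-1) (inord j.-1).

Definition H_a : 'M[C]_4 := E 1 1 - E 2 2.
Definition H_b : 'M[C]_4 := E 2 2 - E 3 3.
Definition H_c : 'M[C]_4 := E 3 3 - E 4 4.
Definition H_0 : 'M[C]_4 := H_a + 2%:R *: H_b + H_c.

(* a, b, c stand for the simple roots alpha, beta, gamma. *)
Definition X_a : 'M[C]_4 := E 1 2.
Definition X_b : 'M[C]_4 := E 2 3.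
Definition X_c : 'M[C]_4 := E 3 4.
Definition X_ab : 'M[C]_4 := E 1 3.
Definition X_bc : 'M[C]_4 := E 2 4.
Definition X_abc : 'M[C]_4 := E 1 4.

Definition Y_a : 'M[C]_4 := X_a^T.
Definition Y_b : 'M[C]_4 := X_b^T.
Definition Y_c : 'M[C]_4 := X_c^T.
Definition Y_ab : 'M[C]_4 := X_ab^T.
Definition Y_bc : 'M[C]_4 := X_bc^T.
Definition Y_abc : 'M[C]_4 := X_abc^T.

End RootVectors.

Arguments H_a {R}. Arguments H_b {R}. Arguments H_c {R}. Arguments H_0 {R}.
Arguments X_a {R}. Arguments X_b {R}. Arguments X_c {R}.
Arguments X_ab {R}. Arguments X_bc {R}. Arguments X_abc {R}.
Arguments Y_a {R}. Arguments Y_b {R}. Arguments Y_c {R}.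
Arguments Y_ab {R}. Arguments Y_bc {R}. Arguments Y_abc {R}.

Section Operators.
Variables (R : realType) (V : lmodType (cplx R)).
Variable rho : 'M[cplx R]_4 -> {linear V -> V}.

Definition K_highest_weight (n : nat) (k : int) (m : nat) (v : V) : Prop :=
  [/\ rho X_a v = 0 /\ rho X_c v = 0, rho H_a v = n%:R *: v,
      rho H_c v = m%:R *: v & rho H_0 v = k%:~R *: v].

(* The scalar operator z. *)
Definition scal (z : int) (v : V) : V := z%:~R *: v.

Definition comm (S T : V -> V) : V -> V := (S \o T) \- (T \o S).

Definition A_abc : V -> V := rho X_abc.

Definition A_b : V -> V :=
  (((rho X_b \o (rho H_a \+ scal 1) \o (rho H_c \+ scal 1))
   \- (rho Y_a \o rho X_ab \o (rho H_c \+ scal 1)))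
   \+ (rho Y_c \o rho X_bc \o (rho H_a \+ scal 1)))
   \- (rho Y_a \o rho Y_c \o rho X_abc).

Definition B_abc : V -> V :=
  (((rho Y_abc \o (rho H_a \+ scal 1) \o (rho H_c \+ scal 1))
   \+ (rho Y_a \o rho Y_bc \o (rho H_c \+ scal 1)))
   \- (rho Y_c \o rho Y_ab \o (rho H_a \+ scal 1)))
   \- (rho Y_a \o rho Y_c \o rho Y_b).

Definition B_b : V -> V := rho Y_b.

Definition Q : V -> V := (rho X_ab \o rho X_bc) \- (rho X_b \o rho X_abc).

Definition R_op : V -> V := (rho Y_ab \o rho Y_bc) \- (rho Y_b \o rho Y_abc).

End Operators.

(* Main.v *)
Require Import Defs.
From HB Require Import structures.
From mathcomp Require Import all_boot all_order all_algebra.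
From mathcomp Require Import complex.
From mathcomp Require Import all_classical all_reals all_analysis.
Import Order.TTheory GRing.Theory Num.Theory numFieldNormedType.Exports.
Local Open Scope ring_scope.

(** The identity holds modulo the left ideal generated by [X_a] and [X_c], that
    is, on every vector [v] that these two operators kill; no assumption on the
    weight of [v] is needed.

    Composing [rho] with the projection [X |-> X - (tr X / 4) 1] extends it to
    a representation of gl(4) ([gl_act]), in which the matrix units satisfy
    [[E_ij, E_kl] = delta_jk E_il - delta_li E_kj] ([gl_actC]).  Both sides of
    the identity are then noncommutative polynomials in the [E_ij], and it
    suffices that their difference lies in the left ideal of U(gl(4)) generated
    by [E_12] and [E_34].  By the Poincare-Birkhoff-Witt theorem this can be
    decided: reorder each monomial with the commutation relations so that
    [E_12] and [E_34] come last, drop the monomials that end in one of them,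
    and collect terms.  All terms cancel ([straighten_identity]).

    Only the soundness of this procedure has to be proved ([applyP]): each of
    its steps preserves the vector obtained by letting the [E_ij] act on [v].
    That the reordering reaches a normal form is not needed, because the
    computation is run and its result is the zero polynomial. *)

(** * Straightening monomials in the matrix units *)

Section Straightening.

Variable N : nat.

(** [(i, j)] stands for the matrix unit [E_ij] of gl(N). *)
Local Notation gen := ('I_N * 'I_N)%type.

(** Noncommutative polynomials in the matrix units with integer coefficients,
    as lists of coefficients and monomials. *)
Local Notation poly := (seq (int * seq gen)).

(** Expressions for elements of the universal enveloping algebra of gl(N). *)
Inductive expr :=
  | Gen of gen
  | Cst of int
  | Add of expr & expr
  | Sub of expr & expr
  | Mul of expr & expr.

(** Adding the term [c w] to [p]; terms that cancel are removed, so that the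
    computation can end with the empty list. *)
Fixpoint add_term (c : int) (w : seq gen) (p : poly) : poly :=
  if p is (d, u) :: q then
    if u == w then (if c + d == 0 then q else (c + d, w) :: q)
    else (d, u) :: add_term c w q
  else if c == 0 then [::] else [:: (c, w)].

(** The polynomial [c p + q]. *)
Definition add_scaled (c : int) (p q : poly) : poly :=
  foldr (fun t r => add_term (c * t.1) t.2 r) q p.

(** Linear extension to polynomials of a map defined on monomials. *)
Definition bind (f : seq gen -> poly) (p : poly) : poly :=
  foldr (fun t r => add_scaled t.1 (f t.2) r) [::] p.

Variables (killed : pred gen) (le : rel gen).

(** [lmul fuel g w] rewrites the product [g w] modulo the left ideal generated
    by the [killed] matrix units: [g] is moved to the right past the smaller
    letters of [w], which creates commutators, and disappears if it is [killed]
    and reaches the end. *)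
Fixpoint lmul (fuel : nat) (g : gen) (w : seq gen) : poly :=
  if fuel is f.+1 then
    if w is h :: u then
      if le g h then [:: (1, g :: w)] else
      add_scaled 1 (bind (lmul f h) (lmul f g u))
        (add_scaled 1 (if g.2 == h.1 then lmul f (g.1, h.2) u else [::])
          (add_scaled (-1) (if h.2 == g.1 then lmul f (h.1, g.2) u else [::])
            [::]))
    else if killed g then [::] else [:: (1, [:: g])]
  else [:: (1, g :: w)].

(** The product of the element denoted by [e] and [p], modulo the same left
    ideal. *)
Fixpoint apply (fuel : nat) (e : expr) (p : poly) : poly :=
  match e with
  | Gen g => bind (lmul fuel g) p
  | Cst c => add_scaled c p [::]
  | Add a b => add_scaled 1 (apply fuel a p) (apply fuel b p)
  | Sub a b => add_scaled (-1) (apply fuel b p) (apply fuel a p)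
  | Mul a b => apply fuel a (apply fuel b p)
  end.

Section Soundness.

Variables (C : comNzRingType) (V : lmodType C) (act : gen -> {linear V -> V}).

(** The operator denoted by an expression. *)
Fixpoint den (e : expr) : V -> V :=
  match e with
  | Gen g => act g
  | Cst c => fun v => c%:~R *: v
  | Add a b => den a \+ den b
  | Sub a b => den a \- den b
  | Mul a b => den a \o den b
  end.

Variable v : V.

(** The vectors obtained by applying a monomial and a polynomial to [v]. *)
Definition monomial (w : seq gen) : V := foldr (fun g => act g) v w.

Definition value (p : poly) : V := \sum_(t <- p) t.1%:~R *: monomial t.2.

Lemma value_nil : value [::] = 0.
Proof. exact: big_nil. Qed.

Lemma value_cons c w p : value ((c, w) :: p) = c%:~R *: monomial w + value p.
Proof. exact: big_cons. Qed.

Lemma value_add_term c w p :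
  value (add_term c w p) = c%:~R *: monomial w + value p.
Proof.
elim: p => [|[d u] q IHq] /=.
  by case: eqP => [->|_]; rewrite ?value_cons // scale0r value_nil addr0.
case: eqP => [->|_]; last by rewrite !value_cons IHq addrCA.
rewrite value_cons addrA -scalerDl -intrD.
by case: eqP => [->|_]; rewrite ?value_cons // scale0r add0r.
Qed.

Lemma value_add_scaled c p q :
  value (add_scaled c p q) = c%:~R *: value p + value q.
Proof.
elim: p => [|[d u] p IHp] /=; first by rewrite value_nil scaler0 add0r.
by rewrite value_add_term IHp value_cons scalerDr scalerA -intrM addrA.
Qed.

Lemma value_bind (g : gen) f p :
    (forall w, value (f w) = act g (monomial w)) ->
  value (bind f p) = act g (value p).
Proof.
move=> fP; elim: p => [|[d u] p IHp] /=; first by rewrite value_nil linear0.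
by rewrite value_add_scaled IHp fP value_cons linearD linearZ.
Qed.

Hypothesis actC : forall g h x,
  act g (act h x) = act h (act g x)
    + ((g.2 == h.1)%:R *: act (g.1, h.2) x
      - (h.2 == g.1)%:R *: act (h.1, g.2) x).

Hypothesis act_killed : forall g, killed g -> act g v = 0.

Lemma value_lmul fuel g w : value (lmul fuel g w) = act g (monomial w).
Proof.
elim: fuel g w => [|f IHf] g w /=.
  by rewrite value_cons value_nil scale1r addr0.
case: w => [|h u] /=.
  case: ifP => [/act_killed ->|_]; first by rewrite value_nil.
  by rewrite value_cons value_nil scale1r addr0.
case: ifP => _; first by rewrite value_cons value_nil scale1r addr0.
have valueMb (b : bool) p : value (if b then p else [::]) = b%:R *: value p.
  by case: b; rewrite ?scale1r // value_nil scale0r.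
rewrite !value_add_scaled !valueMb !IHf (@value_bind h) // IHf value_nil addr0.
by rewrite (actC g h) rmorphN !scale1r scaleN1r.
Qed.

(** Letting polynomials act on [v] turns [apply] into the action of
    expressions. *)
Lemma applyP fuel e p : value (apply fuel e p) = den e (value p).
Proof.
elim: e p => [g|c|a IHa b IHb|a IHa b IHb|a IHa b IHb] p /=.
- by rewrite (@value_bind g) // => w; apply: value_lmul.
- by rewrite value_add_scaled value_nil addr0.
- by rewrite value_add_scaled IHa IHb scale1r.
- by rewrite value_add_scaled IHa IHb rmorphN scaleN1r addrC.
- by rewrite IHa IHb.
Qed.

Lemma den_eq0 fuel e : apply fuel e [:: (1, [::])] = [::] -> den e v = 0.
Proof.
move=> e0; have := applyP fuel e [:: (1, [::])].
by rewrite e0 value_cons !value_nil scale1r addr0.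
Qed.

End Soundness.

End Straightening.

(** * Extending the representation to gl(4) *)

Section Extension.

Variables (R : realType) (V : lmodType (cplx R)).
Local Notation C := (cplx R).
Variable rho : 'M[C]_4 -> {linear V -> V}.

(** The projection of gl(4) onto sl(4) along the scalar matrices. *)
Definition traceless (X : 'M[C]_4) : 'M[C]_4 := X - (\tr X / 4)%:M.

Lemma sl4_traceless X : sl4 (traceless X).
Proof.
by rewrite /sl4 /= raddfB /= mxtrace_scalar -[_ / _ *+ _]mulr_natr divfK ?pnatr_eq0 ?subrr.
Qed.

Lemma traceless_id {X} : sl4 X -> traceless X = X.
Proof. by rewrite /sl4 /= /traceless => ->; rewrite mul0r raddf0 subr0. Qed.

Lemma tracelessD X Y : traceless (X + Y) = traceless X + traceless Y.
Proof. by rewrite /traceless mxtraceD mulrDl raddfD /= addrACA opprD. Qed.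

Lemma tracelessZ a X : traceless (a *: X) = a *: traceless X.
Proof. by rewrite /traceless mxtraceZ scalerBr scale_scalar_mx mulrA. Qed.

Lemma sl4_bracket (X Y : 'M[C]_4) : sl4 (bracket X Y).
Proof. by rewrite /sl4 /= /bracket raddfB /= mxtrace_mulC subrr. Qed.

Lemma bracket_traceless X Y :
  bracket (traceless X) (traceless Y) = traceless (bracket X Y).
Proof.
rewrite (traceless_id (sl4_bracket X Y)) /bracket /traceless.
set a := (\tr X / 4)%:M; set b := (\tr Y / 4)%:M.
rewrite !mulmxBl !mulmxBr -(scalar_mxC _ X) (scalar_mxC _ Y) (scalar_mxC _ b).
by rewrite -/a !opprB addrACA !addrA !subrK.
Qed.

Hypothesis rho_lin : forall (a : C) X Y, sl4 X -> sl4 Y ->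
  forall v, rho (a *: X + Y) v = a *: rho X v + rho Y v.
Hypothesis rho_bracket : forall X Y, sl4 X -> sl4 Y ->
  forall v, rho (bracket X Y) v = rho X (rho Y v) - rho Y (rho X v).

Lemma rho_tracelessB X Y v :
  rho (traceless (X - Y)) v = rho (traceless X) v - rho (traceless Y) v.
Proof.
have -> : X - Y = -1 *: Y + X by rewrite scaleN1r addrC.
rewrite tracelessD tracelessZ rho_lin; try exact: sl4_traceless.
by rewrite scaleN1r addrC.
Qed.

Lemma rho_tracelessMn (b : bool) X v :
  rho (traceless (X *+ b)) v = b%:R *: rho (traceless X) v.
Proof.
case: b; first by rewrite mulr1n scale1r.
by rewrite mulr0n scale0r -(subrr X) rho_tracelessB subrr.
Qed.

(** The action of the matrix units of gl(4). *)
Definition gl_act (g : 'I_4 * 'I_4) : {linear V -> V} :=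
  rho (traceless (delta_mx g.1 g.2)).

Lemma gl_actC g h v :
  gl_act g (gl_act h v) = gl_act h (gl_act g v)
    + ((g.2 == h.1)%:R *: gl_act (g.1, h.2) v
      - (h.2 == g.1)%:R *: gl_act (h.1, g.2) v).
Proof.
set X : 'M[C]_4 := delta_mx g.1 g.2; set Y : 'M[C]_4 := delta_mx h.1 h.2.
rewrite -!rho_tracelessMn -rho_tracelessB -!mul_delta_mx_cond.
rewrite -/(bracket X Y) -bracket_traceless.
have -> := rho_bracket (traceless X) (traceless Y)
  (sl4_traceless X) (sl4_traceless Y) v.
by rewrite [RHS]addrC subrK.
Qed.

End Extension.

(** * The identity *)

(** The matrix unit written [E_ij] with indices [1], ..., [4]; ordinals start
    at [0]. *)
Definition unit4 (i j : nat) : 'I_4 * 'I_4 := (inZp i.-1, inZp j.-1).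

(** The root vectors [X_a] and [X_c], which kill K-highest weight vectors. *)
Definition raising : pred ('I_4 * 'I_4) :=
  fun g => g \in [:: unit4 1 2; unit4 3 4].

(** The position of a matrix unit in the order used for straightening.  The
    raising ones get the largest rank, so that they move to the end of each
    monomial; the order of the others is arbitrary. *)
Definition rank (g : 'I_4 * 'I_4) : nat :=
  if raising g then 16 else (4 * g.1 + g.2)%N.

Definition rank_le : rel ('I_4 * 'I_4) := fun g h => (rank g <= rank h)%N.

(** The operators of the identity and its two sides, as expressions in the
    matrix units. *)
Section Expressions.

Local Notation G i j := (Gen 4 (unit4 i j)).
Local Notation "1" := (Cst 4 1).
Local Notation "2" := (Cst 4 2).
Local Notation "a + b" := (Add 4 a b).
Local Notation "a - b" := (Sub 4 a b).
Local Notation "a * b" := (Mul 4 a b).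

Definition Ha_expr := G 1 1 - G 2 2.
Definition Hb_expr := G 2 2 - G 3 3.
Definition Hc_expr := G 3 3 - G 4 4.

Definition comm_expr a b := a * b - b * a.

Definition Ab_expr :=
  G 2 3 * (Ha_expr + 1) * (Hc_expr + 1) - G 2 1 * G 1 3 * (Hc_expr + 1)
  + G 4 3 * G 2 4 * (Ha_expr + 1) - G 2 1 * G 4 3 * G 1 4.

Definition Babc_expr :=
  G 4 1 * (Ha_expr + 1) * (Hc_expr + 1) + G 2 1 * G 4 2 * (Hc_expr + 1)
  - G 4 3 * G 3 1 * (Ha_expr + 1) - G 2 1 * G 4 3 * G 3 2.

Definition Q_expr := G 1 3 * G 2 4 - G 2 3 * G 1 4.
Definition R_expr := G 3 1 * G 4 2 - G 3 2 * G 4 1.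

Definition lhs_expr := (Ha_expr + Hc_expr + 2) * comm_expr Q_expr R_expr.

Definition rhs_expr :=
  (Hb_expr - 1) * comm_expr Babc_expr (G 1 4)
  + (Ha_expr + Hb_expr + Hc_expr + 1) * comm_expr Ab_expr (G 3 2).

End Expressions.

Lemma straighten_identity :
  (* Soundness holds for every amount of fuel, so any value for which the result
     is empty would do in place of 30. *)
  apply 4 raising rank_le 30 (Sub 4 lhs_expr rhs_expr) [:: (1, [::])] = [::].
Proof. by vm_compute. Qed.

Lemma E_unit4 (R : realType) i j : (i.-1 < 4)%N -> (j.-1 < 4)%N ->
  E R i j = delta_mx (unit4 i j).1 (unit4 i j).2.
Proof.
by move=> lti ltj; congr delta_mx; apply: val_inj; rewrite /= inordK ?modn_small.
Qed.

Lemma sl4_E (R : realType) i j :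
  (i.-1 < 4)%N -> (j.-1 < 4)%N -> i.-1 != j.-1 -> sl4 (E R i j).
Proof.
move=> lti ltj neq_ij; rewrite /sl4 /= /mxtrace big1 // => k _.
rewrite mxE; case: eqP => //= ->; case: eqP => // /(congr1 val) /=.
by rewrite !inordK // => eq_ij; rewrite eq_ij eqxx in neq_ij.
Qed.

Lemma sl4_EB (R : realType) i j : sl4 (E R i i - E R j j).
Proof.
have trE k : \tr (E R k k) = 1.
  rewrite /mxtrace (bigD1 (inord k.-1)) //= mxE !eqxx big1 ?addr0 // => l.
  by rewrite mxE => /negPf->.
by rewrite /sl4 /= raddfB /= !trE subrr.
Qed.

Section Reification.

Variables (R : realType) (V : lmodType (cplx R)).
Variable rho : 'M[cplx R]_4 -> {linear V -> V}.
Hypothesis rho_lin : forall (a : cplx R) X Y, sl4 X -> sl4 Y ->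
  forall v, rho (a *: X + Y) v = a *: rho X v + rho Y v.

Local Notation act := (gl_act R V rho).
Local Notation ev := (den 4 _ V act).

Lemma rho_E i j : (i.-1 < 4)%N -> (j.-1 < 4)%N -> i.-1 != j.-1 ->
  rho (E R i j) = act (unit4 i j).
Proof.
move=> lti ltj neq_ij.
by rewrite /gl_act -E_unit4 // traceless_id //; apply: sl4_E.
Qed.

Lemma rho_tr_E i j : (i.-1 < 4)%N -> (j.-1 < 4)%N -> i.-1 != j.-1 ->
  rho (E R j i)^T = act (unit4 i j).
Proof. by move=> *; rewrite trmx_delta rho_E. Qed.

Lemma rho_EB i j : (i.-1 < 4)%N -> (j.-1 < 4)%N ->
  rho (E R i i - E R j j) = act (unit4 i i) \- act (unit4 j j) :> (V -> V).
Proof.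
move=> lti ltj; apply: funext => v /=; rewrite /gl_act -!E_unit4 //.
by rewrite -rho_tracelessB // (traceless_id _ (sl4_EB _ _ _)).
Qed.

Lemma rho_Ha : rho H_a = ev Ha_expr :> (V -> V). Proof. exact: rho_EB. Qed.
Lemma rho_Hb : rho H_b = ev Hb_expr :> (V -> V). Proof. exact: rho_EB. Qed.
Lemma rho_Hc : rho H_c = ev Hc_expr :> (V -> V). Proof. exact: rho_EB. Qed.

Lemma A_abcE : A_abc rho = act (unit4 1 4).
Proof. by rewrite /A_abc (rho_E 1 4). Qed.

Lemma B_bE : B_b rho = act (unit4 3 2).
Proof. by rewrite /B_b (rho_tr_E 3 2). Qed.

Lemma A_bE : A_b rho = ev Ab_expr.
Proof.
rewrite /A_b rho_Ha rho_Hc (rho_E 2 3) // (rho_tr_E 2 1) // (rho_E 1 3) //.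
by rewrite (rho_tr_E 4 3) // (rho_E 2 4) // (rho_E 1 4).
Qed.

Lemma B_abcE : B_abc rho = ev Babc_expr.
Proof.
rewrite /B_abc rho_Ha rho_Hc (rho_tr_E 4 1) // (rho_tr_E 2 1) //.
by rewrite (rho_tr_E 4 2) // (rho_tr_E 4 3) // (rho_tr_E 3 1) // (rho_tr_E 3 2).
Qed.

Lemma QE : Q rho = ev Q_expr.
Proof.
by rewrite /Q (rho_E 1 3) // (rho_E 2 4) // (rho_E 2 3) // (rho_E 1 4).
Qed.

Lemma R_opE : R_op rho = ev R_expr.
Proof.
rewrite /R_op (rho_tr_E 3 1) // (rho_tr_E 4 2) // (rho_tr_E 3 2) //.
by rewrite (rho_tr_E 4 1).
Qed.

End Reification.

Theorem theorem1 (R : realType) (V : lmodType (cplx R))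
    (rho kappa : 'M[cplx R]_4 -> {linear V -> V})
    (hV : gKmodule rho kappa) (hadm : admissible kappa)
    (n : nat) (k : int) (m : nat) (v : V)
    (hv : K_highest_weight rho n k m v) :
  (((rho H_a \+ rho H_c) \+ scal 2) \o comm (Q rho) (R_op rho)) v =
  (((rho H_b \- scal 1) \o comm (B_abc rho) (A_abc rho))
   \+ ((((rho H_a \+ rho H_b) \+ rho H_c) \+ scal 1)
       \o comm (A_b rho) (B_b rho))) v.
Proof.
have rho_lin := gK_lin hV; have rho_bracket := gK_bracket hV.
have [[Xa0 Xc0] _ _ _] := hv.
have killedP g : raising g -> gl_act R V rho g v = 0.
  by rewrite /raising !inE => /orP[]/eqP->; rewrite -rho_E.
have /subr0_eq := den_eq0 _ _ _ _ _ _ v (gl_actC _ _ _ rho_lin rho_bracket)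
  killedP _ _ straighten_identity.
rewrite rho_Ha // rho_Hb // rho_Hc // A_abcE // B_bE // A_bE // B_abcE //.
by rewrite QE // R_opE.
Qed.
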